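(* Let $p$ be a positive integer. A graph $G$ is a $\mathbf{W}_{p}$ graph if and only if each of its connected components is a $\mathbf{W}_{p}$ graph.
   Context: All graphs are finite, simple, undirected and loopless. An independent set is a set of pairwise non-adjacent vertices; $\alpha(G)$ is the maximum size of an independent set, and a maximum independent set is one of size $\alpha(G)$. For a positive integer $p$, a graph $G$ with $n(G)$ vertices is a $\mathbf{W}_{p}$ graph if $n(G)\geq p$ and for every $p$ pairwise disjoint independent sets $A_1,\ldots,A_p$ of $G$ there exist $p$ pairwise disjoint maximum independent sets $S_1,\ldots,S_p$ of $G$ with $A_i\subseteq S_i$ for $1\le i\le p$. *)

(* Defs.v *)
From mathcomp Require Import all_boot.

Set Implicit Arguments.
Unset Strict Implicit.
Unset Printing Implicit Defensive.

Record sgraph := SGraph {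
  svertex :> finType;
  sedge : rel svertex;
  sedge_sym : symmetric sedge;
  sedge_irrefl : irreflexive sedge
}.

Section Independence.
Variable G : sgraph.

Definition independent (A : {set G}) : bool :=
  [forall x in A, forall y in A, ~~ sedge x y].

Definition alpha : nat := \max_(A : {set G} | independent A) #|A|.

Definition max_independent (S : {set G}) : bool :=
  independent S && (#|S| == alpha).

(* The members of a family may be empty, so a pairwise disjoint family
   need not be injective; disjointness is required for distinct indices. *)
Definition pairwise_disjoint (p : nat) (A : 'I_p -> {set G}) : Prop :=
  forall i j : 'I_p, i != j -> [disjoint A i & A j].

Definition Wgraph (p : nat) : Prop :=
  p <= #|G| /\
  forall A : 'I_p -> {set G},
    (forall i, independent (A i)) -> pairwise_disjoint A ->
    exists S : 'I_p -> {set G},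
      [/\ forall i, max_independent (S i),
          pairwise_disjoint S
        & forall i, A i \subset S i].

End Independence.

Section Components.
Variable G : sgraph.

Section Induced.
Variable U : {set G}.

Definition induced_edge : rel {x : G | x \in U} :=
  [rel u v | sedge (val u) (val v)].

Lemma induced_edge_sym : symmetric induced_edge.
Proof. by move=> u v; exact: sedge_sym. Qed.

Lemma induced_edge_irrefl : irreflexive induced_edge.
Proof. by move=> u; exact: sedge_irrefl. Qed.

Definition induced : sgraph := SGraph induced_edge_sym induced_edge_irrefl.
End Induced.

Definition component (x : G) : {set G} := [set y | connect (@sedge G) x y].

Definition components : {set {set G}} := [set component x | x : G].

End Components.

(* Main.v *)
Require Import Defs.
From mathcomp Require Import all_boot.

(** A maximum independent set of [G] meets every component [C] in a maximum
    independent set of [C], because its part inside [C] can be exchanged for any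
    independent set of [C]; conversely, a union of maximum independent sets of
    the components is maximum in [G].  Hence extensions restrict to components
    and glue back together.  The bound [p <= #|C|] comes from extending [p] empty
    sets: the [p] disjoint extensions all meet [C]. *)

Set Implicit Arguments.
Unset Strict Implicit.
Unset Printing Implicit Defensive.

Lemma independentP (G : sgraph) (A : {set G}) :
  reflect {in A &, forall x y, ~~ sedge x y} (independent A).
Proof.
apply: (iffP 'forall_in_forall_inP) => H x; first by move=> y xA; exact: H.
by move=> xA y; exact: H.
Qed.

Lemma independent0 (G : sgraph) : independent (set0 : {set G}).
Proof. by apply/independentP => x y; rewrite inE. Qed.

Lemma independent1 (G : sgraph) (x : G) : independent [set x].
Proof.
by apply/independentP => _ _ /set1P-> /set1P->; rewrite sedge_irrefl.
Qed.

Lemma max_independentP (G : sgraph) (S : {set G}) :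
  reflect (independent S /\ forall T : {set G}, independent T -> #|T| <= #|S|)
          (max_independent S).
Proof.
apply: (iffP andP) => [[indS /eqP cS]|[indS maxS]]; split=> //.
  by move=> T indT; rewrite cS /alpha; exact: leq_bigmax_cond.
rewrite eqn_leq /alpha leq_bigmax_cond //=.
by apply/bigmax_leqP => T; exact: maxS.
Qed.

Section Induced.
Variables (G : sgraph) (U : {set G}).

(** The vertices of [induced U] form a subtype, so [trace] and [lift] carry sets into it and back.
    Both keep independence, since adjacency in [induced U] is adjacency in [G]. *)
Definition trace (A : {set G}) : {set induced U} := [set u | val u \in A].
Definition lift (B : {set induced U}) : {set G} := [set val u | u in B].

Lemma mem_lift (B : {set induced U}) u : (val u \in lift B) = (u \in B).
Proof. by rewrite mem_imset //; exact: val_inj. Qed.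

Lemma lift_sub (B : {set induced U}) : lift B \subset U.
Proof. by apply/subsetP => _ /imsetP[u _ ->]; exact: (valP u). Qed.

Lemma card_lift (B : {set induced U}) : #|lift B| = #|B|.
Proof. by apply: card_imset; exact: val_inj. Qed.

Lemma lift_trace (A : {set G}) : lift (trace A) = A :&: U.
Proof.
apply/setP => x; apply/imsetP/setIP => [[u]|[xA xU]].
  by rewrite inE => uA ->; split=> //; exact: (valP u).
by exists (exist _ x xU); rewrite ?inE.
Qed.

Lemma card_trace (A : {set G}) : #|trace A| = #|A :&: U|.
Proof. by rewrite -lift_trace card_lift. Qed.

Lemma independent_trace (A : {set G}) : independent A -> independent (trace A).
Proof.
move=> /independentP indA; apply/independentP => u v.
by rewrite !inE; exact: indA.
Qed.

Lemma independent_lift (B : {set induced U}) :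
  independent B -> independent (lift B).
Proof.
move=> /independentP indB; apply/independentP.
by move=> _ _ /imsetP[u uB ->] /imsetP[v vB ->]; exact: indB uB vB.
Qed.

Lemma disjoint_trace (A B : {set G}) :
  [disjoint A & B] -> [disjoint trace A & trace B].
Proof.
move=> /disjointFr dAB; apply/pred0P => u /=; rewrite !inE.
by apply/andP => -[/dAB->].
Qed.

Lemma disjoint_lift (B1 B2 : {set induced U}) :
  [disjoint B1 & B2] -> [disjoint lift B1 & lift B2].
Proof.
move=> /disjointFr dB; apply/pred0P => x /=.
by apply/andP => -[/imsetP[u /dB uB ->]]; rewrite mem_lift uB.
Qed.

End Induced.

Section Components.
Variable G : sgraph.

Lemma component_in (x : G) : x \in component x.
Proof. by rewrite inE connect0. Qed.

Lemma component_components (x : G) : component x \in components G.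
Proof. exact: imset_f. Qed.

(** Symmetry of edges makes reachability an equivalence, so components are its classes. Membership
    thus becomes an equation on the label [component x], by which sums can be partitioned. *)
Lemma component_eq (x : G) (C : {set G}) :
  C \in components G -> (component x == C) = (x \in C).
Proof.
move=> /imsetP[z _ ->]; rewrite inE.
have csym : connect_sym (@sedge G) by apply: sym_connect_sym; exact: sedge_sym.
apply/eqP/idP => [eqC|zx]; first by have := component_in x; rewrite eqC inE.
by apply/setP => y; rewrite !inE (same_connect csym zx).
Qed.

Lemma component_edge (x y : G) : sedge x y -> component x = component y.
Proof.
move=> xy; apply/esym/eqP; rewrite component_eq ?component_components //.
by rewrite inE connect1.
Qed.

Lemma edge_component (C : {set G}) (x y : G) :
  C \in components G -> sedge x y -> (x \in C) = (y \in C).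
Proof. by move=> CG xy; rewrite -!component_eq // (component_edge xy). Qed.

Lemma card_components (T : {set G}) :
  #|T| = \sum_(C in components G) #|T :&: C|.
Proof.
rewrite -sum1_card (partition_big (@component G) (mem (components G))) /=; last first.
  by move=> x _; exact: component_components.
apply: eq_bigr => C CG; rewrite -sum1_card; apply: eq_bigl => x.
by rewrite inE component_eq.
Qed.

Lemma max_independent_trace (C S : {set G}) :
  C \in components G -> max_independent S -> max_independent (trace C S).
Proof.
move=> CG /max_independentP[indS maxS]; apply/max_independentP.
split=> [|T indT]; first exact: independent_trace.
have LC := subsetP (lift_sub T); have /independentP indL := independent_lift indT.
(* The exchange: [T] replaces the part of [S] inside [C]. In the mixed cases an edge would join a
   vertex outside [C] to one inside it. *)
have: #|(S :\: C) :|: lift T| <= #|S|.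
  apply: maxS; apply/independentP => x y.
  move: (indS) => /independentP {}indS.
  rewrite !inE => /orP[/andP[xC xS]|xL] /orP[/andP[yC yS]|yL].
  - exact: indS.
  - by apply: contra xC => xy; rewrite (edge_component CG xy) LC.
  - by apply: contra yC => xy; rewrite -(edge_component CG xy) LC.
  - exact: indL.
(* Splitting [S] along [C] lets [S :\: C] cancel on both sides, once the two pieces of the union are
   known to be disjoint. *)
rewrite cardsU -[#|S|](cardsID C) card_trace card_lift.
suff -> : (S :\: C) :&: lift T = set0 by rewrite cards0 subn0 addnC leq_add2r.
by apply/setP => x; rewrite !inE; apply/andP => -[/andP[/negP xC _] /LC].
Qed.

(** Every edge lies inside one component, so independence is checked there; sizes are compared
    component by component and summed. *)
Lemma max_independent_glue (S : {set G}) :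
  (forall C, C \in components G -> max_independent (trace C S)) ->
  max_independent S.
Proof.
move=> maxS; apply/max_independentP; split=> [|T indT].
  apply/independentP => x y xS yS; apply/negP => xy.
  have CG := component_components x; have xC := component_in x.
  have yC : y \in component x by rewrite -(edge_component CG xy).
  have /max_independentP[/independentP indS _] := maxS _ CG.
  have := indS (exist _ x xC) (exist _ y yC).
  by rewrite !inE => /(_ xS yS)/negP.
rewrite [#|T|]card_components [#|S|]card_components; apply: leq_sum => C CG.
rewrite -!card_trace; have /max_independentP[_] := maxS C CG.
by apply; exact: independent_trace.
Qed.

End Components.

(** Choosing one element from each set gives an injection, by disjointness. *)
Lemma disjoint_nonempty_leq (T : finType) (p : nat) (F : 'I_p -> {set T}) :
  (forall i, F i != set0) -> (forall i j, i != j -> [disjoint F i & F j]) ->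
  p <= #|T|.
Proof.
move=> F0 dF; have /fin_all_exists[f fF] i : exists x, x \in F i by exact/set0Pn.
rewrite -[p]card_ord; apply: (@leq_card _ _ f) => i j fij.
apply/eqP/negPn/negP => /dF/disjointFr/(_ (fF i)).
by rewrite fij fF.
Qed.

Lemma Wgraph_component (p : nat) (G : sgraph) (C : {set G}) :
  C \in components G -> Wgraph G p -> Wgraph (induced C) p.
Proof.
move=> CG [_ WG]; split=> [|A indA dA].
  have [||S [maxS dS _]] := WG (fun=> set0).
  - by move=> _; exact: independent0.
  - by move=> i j _; rewrite disjoints_subset sub0set.
  apply: (@disjoint_nonempty_leq _ _ (fun i => trace C (S i))) => i.
    have /max_independentP[_ maxSi] := max_independent_trace CG (maxS i).
    have /imsetP[x _ defC] := CG; have xC : x \in C by rewrite defC component_in.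
    (* A singleton of [C] is independent, so the maximum set [trace C (S i)] is nonempty. *)
    have := maxSi _ (@independent1 (induced C) (exist _ x xC)).
    by rewrite cards1 card_gt0.
  by move=> j ij; exact/disjoint_trace/dS.
have [||S [maxS dS AS]] := WG (fun i => lift (A i)).
- by move=> i; exact: independent_lift.
- by move=> i j ij; exact/disjoint_lift/dA.
exists (fun i => trace C (S i)); split=> [i|i j ij|i].
- exact: max_independent_trace.
- exact/disjoint_trace/dS.
- by apply/subsetP => u uA; rewrite inE (subsetP (AS i)) // mem_lift.
Qed.

Lemma Wgraph_glue (p : nat) (G : sgraph) (hG : 0 < #|G|) :
  (forall C : {set G}, C \in components G -> Wgraph (induced C) p) ->
  Wgraph G p.
Proof.
move=> WC; split=> [|A indA dA].
  (* With no vertices the hypothesis would be vacuous; [x] provides a component, which already has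
     [p] vertices. *)
  have /card_gt0P[x _] := hG.
  have [/leq_trans-> //] := WC _ (component_components x).
  by rewrite -cardsT -(card_lift setT) max_card.
(* Choice needs a family for every set [C], hence the inner premise and the dummy empty family off
   the components. *)
have /fin_all_exists[F HF] (C : {set G}) : exists S : 'I_p -> {set induced C},
    C \in components G ->
    [/\ forall i, max_independent (S i), pairwise_disjoint S
      & forall i, trace C (A i) \subset S i].
  case: (boolP (C \in components G)) => [CG|_]; last by exists (fun=> set0).
  have [||S HS] := (WC C CG).2 (fun i => trace C (A i)); last by exists S.
  - by move=> i; exact: independent_trace.
  - by move=> i j ij; exact/disjoint_trace/dA.
(* Each vertex consults the family of its own component, so [S i] is the union of the lifted [F C i]
   over all components [C]. *)
pose S i := [set x | x \in lift (F (component x) i)].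
have traceS C i : C \in components G -> trace C (S i) = F C i.
  move=> CG; apply/setP => u; rewrite !inE.
  have /eqP-> : component (val u) == C by rewrite component_eq //; exact: (valP u).
  exact: mem_lift.
exists S; split=> [i|i j ij|i].
- apply: max_independent_glue => C CG; rewrite traceS //.
  by have [] := HF C CG.
- apply/pred0P => x /=; rewrite !inE; apply/negP/negP.
  have [_ /(_ i j ij)/disjoint_lift/disjointFr dF _] :=
    HF _ (component_components x).
  by apply/andP => -[/dF->].
- apply/subsetP => x xA; rewrite inE.
  have [_ _ /(_ i)/subsetP sF] := HF _ (component_components x).
  (* Viewing [x] as a vertex of its own component makes [mem_lift] applicable. *)
  have -> : x = val (exist _ x (component_in x) : induced (component x)) by [].
  by rewrite mem_lift sF // inE.
Qed.

Theorem theorem2p6 (p : nat) (G : sgraph) (hp : 0 < p) (hG : 0 < #|G|) :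
  Wgraph G p <->
  (forall C : {set G}, C \in components G -> Wgraph (induced C) p).
Proof.
by split=> [WG C CG|]; [exact: Wgraph_component | exact: Wgraph_glue].
Qed.
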